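(* Let $H$ be a finite connected undirected graph (without multiple edges) which is not bipartite. Then the hom-shift $\mathrm{Hom}(\mathbb{Z}^d,H)$ has property $F$ witnessed by a family of patterns $\mathcal{P}$ whose entropy $h(\mathcal{P})$ equals the topological entropy of $\mathrm{Hom}(\mathbb{Z}^d,H)$.
   Context: $\mathrm{Hom}(\mathbb{Z}^d,H)$ is the set of maps $x:\mathbb{Z}^d\to V(H)$ sending vertices adjacent in $\mathbb{Z}^d$ (i.e. differing by a standard unit vector) to adjacent vertices of $H$, with the shift action $(\sigma^\gamma x)_\delta=x_{\gamma+\delta}$. For a symbolic system $X$ (shift-invariant subset of $\mathcal{A}^{\mathbb{Z}^d}$), $\mathcal{L}(X,B)=\{x|_B:x\in X\}$. A $k$-grid union is a set $B=\gamma+C+[1,k]^d$ with $C\subseteq k\mathbb{Z}^d$, $\gamma\in\mathbb{Z}^d$, such that $B$ and $\mathbb{Z}^d\setminus B$ are connected. A family of patterns $\mathcal{P}=(P_C)$ indexed by $k$-grid unions, with $P_C\subseteq\mathcal{L}(X,C)$ and translation invariant (a pattern on $C$ is in $P_C$ iff its translate to $C+\alpha$ is in $P_{C+\alpha}$), has property $F$ with gap $m$ if (1) for all $k$-grid unions $C,C_1,\dots,C_r$ and $c_i\in P_{C_i}$ with the $C_j+[-m,m]^d$ pairwise disjoint and contained in $C$, there is $c\in P_C$ with $c|_{C_j}=c_j$ for all $j$; (2) any $x\in\mathcal{A}^{\mathbb{Z}^d}$ with $x|_C\in P_C$ for all $C$ in an increasing sequence of $k$-grid unions covering $\mathbb{Z}^d$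 lies in $X$. $X$ has property $F$ (witnessed by $\mathcal{P}$) if such $k,m,\mathcal{P}$ exist. The entropy of $\mathcal{P}$ is $h(\mathcal{P})=\liminf_n(nk)^{-d}\log|P_{[1,nk]^d}|$. *)

(* Defs.v *)
From Stdlib Require Import ZArith Reals.
From Coquelicot Require Import Coquelicot.
From mathcomp Require Import all_boot.
From mathcomp Require Import boolp.

Set Implicit Arguments. Unset Strict Implicit. Unset Printing Implicit Defensive.

Definition pt (d : nat) := 'I_d -> Z.

Definition peq {d} (p q : pt d) : Prop := forall i, p i = q i.

Definition adjZ {d} (p q : pt d) : Prop :=
  exists (i : 'I_d) (s : Z), (s = 1 \/ s = -1)%Z /\
    forall j, q j = (p j + (if j == i then s else 0))%Z.

Definition Hom (d : nat) (T : finType) (e : rel T) (x : pt d -> T) : Prop :=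
  forall p q : pt d, adjZ p q -> e (x p) (x q).

Definition graph_connected (T : finType) (e : rel T) : Prop :=
  forall u v : T, connect e u v.
Definition bipartite (T : finType) (e : rel T) : Prop :=
  exists c : T -> bool, forall u v, e u v -> c u != c v.

Definition in_box {d} (k : nat) (r : pt d) : Prop :=
  forall i, (1 <= r i <= Z.of_nat k)%Z.
Definition in_cube {d} (m : nat) (r : pt d) : Prop :=
  forall i, (- Z.of_nat m <= r i <= Z.of_nat m)%Z.
Definition in_kZ {d} (k : nat) (p : pt d) : Prop :=
  forall i, exists z : Z, p i = (Z.of_nat k * z)%Z.

Inductive reach {d} (S : pt d -> Prop) : pt d -> pt d -> Prop :=
| reach_refl : forall p q, peq p q -> reach S p q
| reach_step : forall p q r, reach S p q -> adjZ q r -> S r -> reach S p r.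

Definition connectedZ {d} (S : pt d -> Prop) : Prop :=
  forall p q, S p -> S q -> reach S p q.

Definition gu_set {d} (k : nat) (gamma : pt d) (C : pt d -> Prop) (p : pt d) : Prop :=
  exists c r, C c /\ in_box k r /\ forall i, p i = (gamma i + c i + r i)%Z.

Definition is_grid_union {d} (k : nat) (B : pt d -> Prop) : Prop :=
  exists (gamma : pt d) (C : pt d -> Prop),
    (forall c, C c -> in_kZ k c) /\
    (forall p, B p <-> gu_set k gamma C p) /\
    connectedZ B /\ connectedZ (fun p => ~ B p).

Definition thick {d} (m : nat) (S : pt d -> Prop) (p : pt d) : Prop :=
  exists q r, S q /\ in_cube m r /\ forall i, p i = (q i + r i)%Z.

(* Patterns on a set S are represented by total maps pt d -> T, considered
   up to agreement on S. *)
Definition agree {d} {T : Type} (S : pt d -> Prop) (x y : pt d -> T) : Prop :=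
  forall p, S p -> x p = y p.

Definition inL {d} {T : Type} (X : (pt d -> T) -> Prop) (S : pt d -> Prop)
  (c : pt d -> T) : Prop := exists x, X x /\ agree S x c.

Definition psub {d} (p a : pt d) : pt d := fun i => (p i - a i)%Z.

(* A family of patterns indexed by sets: P B c means "c|_B is in P_B". *)
Definition patfam d (T : Type) := (pt d -> Prop) -> (pt d -> T) -> Prop.

(* Coherence of the representation: P_B depends only on the set B and on
   the restriction of the pattern to B. *)
Definition family_wd {d} {T : Type} (P : patfam d T) : Prop :=
  forall B B' c c', (forall p, B p <-> B' p) -> agree B c c' -> P B c -> P B' c'.

Definition property_F_with {d} {T : Type} (X : (pt d -> T) -> Prop)
  (k m : nat) (P : patfam d T) : Prop :=
  (0 < k)%N /\
  family_wd P /\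
  (forall B c, is_grid_union k B -> P B c -> inL X B c) /\
  (forall B (a : pt d) c, is_grid_union k B ->
     (P B c <-> P (fun p => B (psub p a)) (fun p => c (psub p a)))) /\
  (forall (B : pt d -> Prop) (r : nat) (Bs : nat -> pt d -> Prop) (cs : nat -> pt d -> T),
     is_grid_union k B ->
     (forall j, (j < r)%N -> is_grid_union k (Bs j) /\ P (Bs j) (cs j)) ->
     (forall j j', (j < r)%N -> (j' < r)%N -> j <> j' ->
        forall p, ~ (thick m (Bs j) p /\ thick m (Bs j') p)) ->
     (forall j, (j < r)%N -> forall p, thick m (Bs j) p -> B p) ->
     exists c, P B c /\ forall j, (j < r)%N -> agree (Bs j) c (cs j)) /\
  (forall (Bn : nat -> pt d -> Prop) (x : pt d -> T),
     (forall n, is_grid_union k (Bn n)) ->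
     (forall n p, Bn n p -> Bn n.+1 p) ->
     (forall p, exists n, Bn n p) ->
     (forall n, P (Bn n) x) -> X x).

Definition boxset {d} (N : nat) (p : pt d) : Prop :=
  forall i, (1 <= p i <= Z.of_nat N)%Z.
Definition bx (d N : nat) := {ffun 'I_d -> 'I_N}.
Definition pt_of {d N} (f : bx d N) : pt d := fun i => Z.of_nat (f i).+1.
Definition restrict {d} {T : finType} (N : nat) (x : pt d -> T) : {ffun bx d N -> T} :=
  [ffun f => x (pt_of f)].

Definition count_box {d} {T : finType} (N : nat) (S : (pt d -> T) -> Prop) : nat :=
  #|[set r : {ffun bx d N -> T} | `[< exists c, S c /\ restrict N c = r >]]|.

Definition entropy_family {d} {T : finType} (k : nat) (P : patfam d T) : Rbar :=
  LimInf_seq (fun n => (ln (INR (count_box (n.+1 * k) (P (boxset (n.+1 * k)))))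
                        / (INR (n.+1 * k) ^ d))%R).

Definition top_entropy {d} {T : finType} (X : (pt d -> T) -> Prop) : Rbar :=
  Lim_seq (fun n => (ln (INR (count_box n.+1 X)) / (INR n.+1 ^ d))%R).

(* Main.v *)
(** Fix an edge v0 v1 of H. With k = 1, let P_B consist of the patterns on B that
    extend to a homomorphism equal to a v0/v1-checkerboard, of either phase,
    outside B. As H is connected and not bipartite, it has a walk which starts
    by alternating between v0 and v1 in one phase and ends by alternating in the
    other; reading this walk along the distance to B switches the phase outside
    B within a bounded distance, which yields the gluing property.

    For the entropy, choose by pigeonhole a boundary pattern of [0, N]^d having
    at least count / |T|^(boundary size) fillings. Reflected copies of such
    fillings tile a box of M^d cells, independently in every cell. The values on
    the boundary of this box are a folded copy of one fixed pattern z on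
    [0, N]^d. Outside, a point at l1-distance t from the box whose projection to
    the box folds to v receives the value of z after t steps of a path from v to
    the origin (then of a walk in H from z 0 to v0, v1, v0, ...). Hence the
    checkerboard is reached within a distance that does not depend on M, and the
    entropy of P is at least that of the hom-shift. *)

Require Import Defs.
From Stdlib Require Import ZArith Reals Lia Lra.
From Coquelicot Require Import Coquelicot.
From mathcomp Require Import all_boot.
From mathcomp Require Import boolp zify.

Set Implicit Arguments. Unset Strict Implicit. Unset Printing Implicit Defensive.

Local Open Scope nat_scope.

(** * Walks *)

Definition walk (T : Type) (e : rel T) (w : nat -> T) : Prop :=
  forall n, e (w n) (w n.+1).

(** Serves twice: in the double cover for the change of phase, and in the graph itself for the tail
    of [contr]. *)
Lemma connect_eventually_alternating_walk (T : finType) (e : rel T) (a b b' : T) :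
  symmetric e -> connect e a b -> e b b' ->
  exists w S, [/\ walk e w, w 0 = a
    & forall n, w (S + n) = if odd n then b' else b].
Proof.
move=> esym /connectP[p]; elim: p a => [|c p IHp] a /=.
  move=> _ -> ebb'; exists (fun n => if odd n then b' else a), 0.
  by split=> // n /=; case: (odd n); rewrite // esym.
case/andP=> eac pp lp ebb'; have [w [S [ww w0 wS]]] := IHp _ pp lp ebb'.
exists (fun n => if n is n'.+1 then w n' else a), S.+1.
by split=> // -[|n] //=; rewrite ?w0 //; apply: ww.
Qed.

(* The bipartite double cover: an odd closed walk in the graph is a path
   between the two lifts of its base point. *)
Definition dcover (T : finType) (e : rel T) : rel (T * bool) :=
  fun x y => e x.1 y.1 && (x.2 != y.2).

Lemma dcover_sym (T : finType) (e : rel T) : symmetric e -> symmetric (dcover e).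
Proof. by move=> es x y; rewrite /dcover es eq_sym. Qed.

(** Swapping the two sheets is an automorphism of the double cover. *)
Lemma connect_dcover_flip (T : finType) (e : rel T) (u v : T) (s t : bool) :
  connect (dcover e) (u, s) (v, t) -> connect (dcover e) (u, ~~ s) (v, ~~ t).
Proof.
case/connectP=> p; elim: p u s => [|[w r] p IHp] u s /=.
  by move=> _ [-> ->].
case/andP=> euw pp lp; apply: connect_trans (IHp _ _ pp lp).
by apply: connect1; move: euw; rewrite /dcover /= (inj_eq negb_inj).
Qed.

Lemma connect_dcover_lift (T : finType) (e : rel T) (u v : T) (s : bool) :
  connect e u v -> exists t, connect (dcover e) (u, s) (v, t).
Proof.
case/connectP=> p; elim: p u s => [|w p IHp] u s /=.
  by move=> _ ->; exists s.
case/andP=> euw pp lp; have [t ct] := IHp _ (~~ s) pp lp.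
exists t; apply: connect_trans ct; apply: connect1.
by rewrite /dcover /= euw; case: s.
Qed.

(** Otherwise colouring [u] by whether [(u, true)] is reachable from [(v, false)] would be a
    bipartition. *)
Lemma nonbipartite_dcover_connected (T : finType) (e : rel T) (v : T) :
  symmetric e -> graph_connected e -> ~ bipartite e ->
  connect (dcover e) (v, false) (v, true).
Proof.
move=> es ec nb; apply: contrapT => nc; apply: nb.
have csym : connect_sym (dcover e).
  by apply: sym_connect_sym; apply: dcover_sym.
exists (fun u => connect (dcover e) (v, false) (u, true)) => a b eab.
apply/negP => /eqP cab; case ca : (connect _ _ (a, true)) in cab.
  (* Both ends coloured [true]: the flipped path to [b] leads back from [(b, false)] to
     [(v, true)]. *)
  have cb := connect_dcover_flip (esym cab); rewrite csym /= in cb.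
  apply: nc; apply: connect_trans cb; apply: connect_trans ca _.
  by apply: connect1; rewrite /dcover /= eab.
(* Both coloured [false]: a lifted path from [v] to [a] ends at [(a, false)], so the edge to [b]
   reaches [(b, true)]. *)
have [[] cva] := connect_dcover_lift false (ec v a); first by rewrite ca in cva.
suff : connect (dcover e) (v, false) (b, true) by rewrite -cab.
by apply: connect_trans cva _; apply: connect1; rewrite /dcover /= eab.
Qed.

Lemma nonbipartite_edge (T : finType) (e : rel T) :
  ~ bipartite e -> exists u v, e u v.
Proof.
move=> nb; apply: contrapT => ne; apply: nb.
by exists (fun=> true) => u v euv; case: ne; exists u, v.
Qed.

(** The sheet records the parity of time, so joining the two lifts of [v0] takes an odd number of
    steps, and the final alternation is out of phase with the start. The value [v1] is prefixed at
    time 0. *)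
Lemma phase_switching_walk (T : finType) (e : rel T) (v0 v1 : T) :
  symmetric e -> graph_connected e -> ~ bipartite e -> e v0 v1 ->
  exists w S, [/\ walk e w, w 0 = v1, w 1 = v0
    & forall n, S <= n -> w n = if odd n then v1 else v0].
Proof.
move=> es ec nb e01.
have c01 := nonbipartite_dcover_connected v0 es ec nb.
have e2 : dcover e (v0, true) (v1, false) by rewrite /dcover /= e01.
have [w [S [ww w0 wS]]] :=
  connect_eventually_alternating_walk (dcover_sym es) c01 e2.
have par n : (w n).2 = odd n.
  elim: n => [|n IHn]; first by rewrite w0.
  by have := ww n; rewrite /dcover IHn /= => /andP[_]; case: (w _).2 (odd n) => [] [].
exists (fun n => if n is n'.+1 then (w n').1 else v1), S.+1; split=> //.
- by case=> [|n]; [rewrite w0 /= es | have /andP[] := ww n].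
- by rewrite w0.
case=> // n; rewrite ltnS => /subnKC <-; rewrite wS.
have := par S; rewrite -[S in w S]addn0 wS /= => oS.
by rewrite oddD -oS /=; case: (odd _).
Qed.

(** * Checkerboards and the gluing property *)

Section Parity.
Variable d : nat.

Definition par (p : pt d) : bool := \big[addb/false]_(i < d) Z.odd (p i).

Definition pinc (p : pt d) (i : 'I_d) : pt d :=
  fun j => (p j + (if j == i then 1 else 0))%Z.

Lemma adjZP (p q : pt d) :
  adjZ p q <-> exists i, q = pinc p i \/ p = pinc q i.
Proof.
split.
  case=> i [s [[->|->] hq]]; exists i; [left|right]; apply/funext => j.
    exact: hq.
  by rewrite /pinc hq; case: ifP => _; lia.
case=> i [->|->]; exists i; [exists 1%Z | exists (-1)%Z]; split; auto=> j.
by rewrite /pinc; case: ifP => _; lia.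
Qed.

Lemma par_pinc (p : pt d) i : par (pinc p i) = ~~ par p.
Proof.
rewrite /par (bigD1 i) //= [in RHS](bigD1 i) //= /pinc eqxx Z.odd_add.
have -> : xorb (Z.odd (p i)) (Z.odd 1) = ~~ Z.odd (p i) by case: Z.odd.
rewrite addNb; congr (~~ (_ (+) _)).
by apply: eq_bigr => j /negbTE ->; rewrite Z.add_0_r.
Qed.

Lemma par_psub (p a : pt d) : par (psub p a) = par p (+) par a.
Proof.
rewrite /par -big_split; apply: eq_bigr => i _.
by rewrite /psub Z.odd_sub; case: (Z.odd _); case: (Z.odd _).
Qed.

Variables (T : finType) (e : rel T).
Hypothesis esym : symmetric e.

Lemma Hom_pinc (x : pt d -> T) : Hom e x <-> forall p i, e (x p) (x (pinc p i)).
Proof.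
split=> [hx p i|hx p q /adjZP[i [->|->]]] //.
  by apply: hx; apply/adjZP; exists i; left.
by rewrite esym.
Qed.

Variables v0 v1 : T.
Hypothesis e01 : e v0 v1.

Definition chk (s : bool) (p : pt d) : T := if par p (+) s then v1 else v0.

Lemma Hom_chk s : Hom e (chk s).
Proof.
apply/Hom_pinc => p i; rewrite /chk par_pinc.
by case: (par p) s => [] []; rewrite //= esym.
Qed.

End Parity.

Section PropertyF.
Variable d : nat.

Lemma thick0 (B : pt d -> Prop) p : B p -> thick 0 B p.
Proof.
move=> Bp; exists p, (fun=> 0%Z); do ! split=> //.
by move=> i; rewrite Z.add_0_r.
Qed.

Lemma thick0_inv (B : pt d -> Prop) p : thick 0 B p -> B p.
Proof.
case=> q [r [Bq [r0 pE]]]; suff -> : p = q by [].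
by apply/funext => i; have := r0 i; rewrite pE; lia.
Qed.

Lemma thick_widen m n (B : pt d -> Prop) p : m <= n -> thick m B p -> thick n B p.
Proof.
move=> mn [q [r [Bq [rm pE]]]]; exists q, r; do ! split=> //.
all: by have := rm i; lia.
Qed.

Lemma thick_adj n (B : pt d -> Prop) p q :
  adjZ p q -> thick n B p -> thick n.+1 B q.
Proof.
case=> i [s [hs hq]] [b [r [Bb [rn pE]]]].
exists b, (fun j => (r j + (if j == i then s else 0))%Z); do ! split=> //.
- by have := rn i0; case: ifP; lia.
- by have := rn i0; case: ifP; lia.
by move=> j; rewrite hq pE; lia.
Qed.

Lemma adjZ_sym (p q : pt d) : adjZ p q -> adjZ q p.
Proof.
by move=> /adjZP[i []?]; apply/adjZP; exists i; [right | left].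
Qed.

Lemma exists_thick (B : pt d -> Prop) b p : B b -> exists n, thick n B p.
Proof.
move=> Bb; exists (\sum_(i < d) Z.abs_nat (p i - b i)), b, (psub p b).
do ! split=> //; last by move=> i; rewrite /psub; lia.
all: by rewrite (bigD1 i) //= /psub; lia.
Qed.

Variables (T : finType) (e : rel T) (v0 v1 : T).
Hypotheses (esym : symmetric e) (e01 : e v0 v1).

Local Notation chk := (chk v0 v1).

Lemma adj_par (p q : pt d) : adjZ p q -> par q = ~~ par p.
Proof.
by move=> /adjZP[i [->|->]]; rewrite par_pinc ?negbK.
Qed.

(** Outside [B] the new configuration reads the phase-switching walk at a time close to the
    sup-distance [D] to [B]. The bound [m] comes from the walk alone. *)
Lemma phase_change : graph_connected e -> ~ bipartite e ->
  exists m, forall (B : pt d -> Prop) x s, Hom e x ->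
    (forall p, ~ B p -> x p = chk s p) ->
  exists y, [/\ Hom e y, agree B y x
    & forall p, ~ thick m B p -> y p = chk false p].
Proof.
move=> ec nb; have [w [m [ww w0 w1 wm]]] := phase_switching_walk esym ec nb e01.
exists m => B x [] hx xB; last first.
  exists x; split=> // p np; apply: xB => Bp; apply: np.
  exact: thick_widen (thick0 Bp).
(* There is no distance to an empty [B], but agreement on it is vacuous. *)
have [[b Bb]|B0] := pselect (exists b, B b); last first.
  exists (chk false); split=> //; first exact: Hom_chk.
  by move=> p Bp; case: B0; exists p.
have exD p : exists n, `[< thick n B p >].
  by have [n ?] := exists_thick p Bb; exists n; apply/asboolP.
pose D p := ex_minn (exD p).
have DP p : thick (D p) B p by rewrite /D; case: ex_minnP => n /asboolP.
have Dmin p n : thick n B p -> D p <= n.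
  by rewrite /D; case: ex_minnP => k _ mink tn; apply: mink; apply/asboolP.
have D_gt0 p : ~ B p -> 0 < D p.
  by case: (posnP (D p)) (DP p) => // -> /thick0_inv.
have Dadj p q : adjZ p q -> D q <= (D p).+1.
  by move=> pq; apply: Dmin; apply: thick_adj pq _.
(* The sup-distance can stay constant along an edge; rounding it down to the parity of [p] makes the
   time change by exactly one along each edge outside [B]. *)
pose f p := if odd (D p) == par p then D p else (D p).-1.
have f_odd p : ~ B p -> odd (f p) = par p.
  move=> /D_gt0; rewrite /f; case: eqP => // /eqP.
  by case: (D p) => // n; rewrite /=; case: odd; case: par.
(* The walk starts with [v1], [v0], which is the phase of [x] just outside [B]. *)
have w_near p : ~ B p -> D p <= 1 -> w (f p) = chk true p.
  move=> nBp Dp1; have Dp : D p = 1 by have := D_gt0 _ nBp; lia.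
  by rewrite /f Dp /chk; case: par; rewrite /= ?w0 ?w1.
have w_adj p q : ~ B p -> ~ B q -> adjZ p q -> e (w (f p)) (w (f q)).
  move=> nBp nBq pq; have := adj_par pq; rewrite -!f_odd // => fo.
  have [] : f q = (f p).+1 \/ f p = (f q).+1.
  - have := Dadj _ _ pq; have := Dadj _ _ (adjZ_sym pq).
    have := D_gt0 _ nBp; have := D_gt0 _ nBq.
    by move: fo; rewrite /f; do 2 case: ifP => _; lia.
  - by move=> ->.
  by move=> ->; rewrite esym.
have x_adj p q : B p -> ~ B q -> adjZ p q -> e (x p) (w (f q)).
  move=> Bp nBq pq; rewrite w_near //; last first.
    by apply: leq_trans (Dadj _ _ pq) _; rewrite ltnS; apply: Dmin; apply: thick0.
  by rewrite -xB //; apply: hx.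
exists (fun p => if `[< B p >] then x p else w (f p)); split.
- move=> p q pq; case: asboolP => Bp; case: asboolP => Bq; auto.
  by rewrite esym; apply: x_adj => //; apply: adjZ_sym.
- by move=> p Bp; case: asboolP.
move=> p np; have mD : m < D p.
  by rewrite ltnNge; apply/negP => Dm; apply: np; apply: thick_widen (DP p).
case: asboolP => [Bp|nBp].
  by have := Dmin _ _ (thick0 Bp); move: mD; case: (D p).
rewrite wm; last by rewrite /f; case: ifP; lia.
by rewrite f_odd // /chk addbF.
Qed.

Definition chkfam : patfam d T := fun B c =>
  exists x s, [/\ Hom e x, agree B x c & forall p, ~ B p -> x p = chk s p].

Lemma chkfam_wd : family_wd chkfam.
Proof.
move=> B B' c c' BB' cc' [x [s [hx xc xs]]]; exists x, s; split=> //.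
  by move=> p /BB' Bp; rewrite xc // cc'.
by move=> p nB'p; apply: xs => /BB'.
Qed.

(** Translation by [a] changes the phase by the parity of [a]; allowing both phases in [chkfam]
    absorbs this. *)
Lemma chkfam_translate (B : pt d -> Prop) (a : pt d) c :
  chkfam B c -> chkfam (fun p => B (psub p a)) (fun p => c (psub p a)).
Proof.
case=> x [s [hx xc xs]]; exists (fun p => x (psub p a)), (par a (+) s); split.
- move=> p q [i [t [ht hq]]]; apply: hx; exists i, t; split=> // j.
  by rewrite /psub hq; lia.
- by move=> p; apply: xc.
by move=> p /xs ->; rewrite /chk par_psub addbA.
Qed.

(** Pieces that all have phase [false] are pasted over one common checkerboard. The gap is [m.+1] so
    that an edge leaving the [m]-thickening of a piece still ends where that piece is read. *)
Lemma chkfam_glue m (B : pt d -> Prop) (r : nat) (Bs : nat -> pt d -> Prop)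
    (ys : nat -> pt d -> T) :
  (forall j, j < r -> Hom e (ys j) /\
     forall p, ~ thick m (Bs j) p -> ys j p = chk false p) ->
  (forall j j', j < r -> j' < r -> j <> j' ->
     forall p, ~ (thick m.+1 (Bs j) p /\ thick m.+1 (Bs j') p)) ->
  (forall j, j < r -> forall p, thick m.+1 (Bs j) p -> B p) ->
  exists c, chkfam B c /\ forall j, j < r -> agree (Bs j) c (ys j).
Proof.
move=> hys dis sub.
pose near p (j : 'I_r) := `[< thick m.+1 (Bs j) p >].
pose c p := if [pick j | near p j] is Some j then ys j p else chk false p.
have cin j p : j < r -> thick m.+1 (Bs j) p -> c p = ys j p.
  move=> jr tp; rewrite /c; case: pickP => [j' /asboolP tp'|/(_ (Ordinal jr))].
    have [<- //|/eqP jj'] := eqVneq (nat_of_ord j') j.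
    by case: (dis _ _ (ltn_ord j') jr jj' p).
  by rewrite /near /= => /asboolP.
have cout p : (forall j, j < r -> ~ thick m.+1 (Bs j) p) -> c p = chk false p.
  by move=> np; rewrite /c; case: pickP => // j /asboolP /np -/(_ (ltn_ord j)).
have cfar j p : j < r -> ~ thick m (Bs j) p -> thick m.+1 (Bs j) p ->
    c p = chk false p.
  by move=> jr np tp; rewrite (cin j) //; apply: (proj2 (hys _ jr)).
have cc p : (forall j, j < r -> ~ thick m (Bs j) p) -> c p = chk false p.
  move=> np; have [[j [jr tp]]|nt] := pselect (exists j, j < r /\ thick m.+1 (Bs j) p).
    by apply: cfar tp => //; apply: np.
  by apply: cout => j jr tp; apply: nt; exists j.
have hc p q : adjZ p q -> (exists j, j < r /\ thick m (Bs j) p) -> e (c p) (c q).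
  move=> pq [j [jr tp]]; rewrite (cin j) //; last exact: thick_widen tp.
  by rewrite (cin j) //; [apply: (proj1 (hys _ jr)) | apply: thick_adj tp].
exists c; split; last first.
  move=> j jr p Bp; apply: cin => //; exact: thick_widen (thick0 Bp).
exists c, false; split=> //.
  move=> p q pq.
  have [tp|np] := pselect (exists j, j < r /\ thick m (Bs j) p); first exact: hc.
  have [tq|nq] := pselect (exists j, j < r /\ thick m (Bs j) q).
    by rewrite esym; apply: hc => //; apply: adjZ_sym.
  rewrite !cc.
  - exact: Hom_chk pq.
  - by move=> j jr tq; apply: nq; exists j.
  - by move=> j jr tp; apply: np; exists j.
by move=> p nBp; apply: cout => j jr tp; apply: nBp; apply: sub tp.
Qed.

Lemma chkfam_property_F : graph_connected e -> ~ bipartite e ->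
  exists m, property_F_with (Hom e) 1 m chkfam.
Proof.
move=> ec nb; have [m pm] := phase_change ec nb; exists m.+1.
split=> //; split; first exact: chkfam_wd.
split; first by move=> B c _ [x [s [hx xc _]]]; exists x.
split.
  move=> B a c _; split; first exact: chkfam_translate.
  move=> /(@chkfam_translate _ (fun i => - a i)%Z).
  have K p : psub (psub p (fun i => - a i)%Z) a = p.
    by apply/funext => i; rewrite /psub; lia.
  by apply: chkfam_wd => p; rewrite K.
split.
  move=> B r Bs cs _ hP dis sub.
  have /choice[ys hys] j : exists y : pt d -> T, j < r ->
      [/\ Hom e y, agree (Bs j) y (cs j)
        & forall p, ~ thick m (Bs j) p -> y p = chk false p].
    have [jr|/negP nj] := boolP (j < r); last by exists (cs j).
    have [_ [x [s [hx xc xs]]]] := hP _ jr.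
    have [y [hy yx yf]] := pm _ _ _ hx xs; exists y => _; split=> //.
    by move=> p Bp; rewrite yx // xc.
  have [|c [Pc cys]] := chkfam_glue (ys := ys) _ dis sub.
    by move=> j /hys[].
  exists c; split=> // j jr p Bp; have [_ ysc _] := hys _ jr.
  by rewrite (cys j) // ysc.
(* Both ends of an edge lie in one set of the exhaustion, where [x] agrees with a homomorphism. *)
move=> Bn x _ inc cov hP p q pq.
have incm n k y : Bn n y -> Bn (n + k) y.
  by elim: k => [|k IHk]; rewrite ?addn0 // addnS => /IHk; apply: inc.
have [a Ba] := cov p; have [b Bb] := cov q.
have [y [s [hy yx _]]] := hP (a + b).
rewrite -!yx ?hy //; first by rewrite addnC; apply: incm.
exact: incm.
Qed.

End PropertyF.

(** * Contraction of patterns and reflected tilings *)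

Section Contraction.
Variables (d : nat) (T : finType) (e : rel T).
Hypothesis esym : symmetric e.

Definition ninc (v : 'I_d -> nat) (i : 'I_d) : 'I_d -> nat :=
  fun j => v j + (j == i).

Definition nzero (v : 'I_d -> nat) : bool := [forall i, v i == 0].

(* One step towards the origin along the first nonzero coordinate; the zero
   coordinates before it are unaffected because [0.-1 = 0]. *)
Definition nprev (v : 'I_d -> nat) : 'I_d -> nat :=
  fun i => if [forall j : 'I_d, (j < i) ==> (v j == 0)] then (v i).-1 else v i.

Lemma nprevK v : ~~ nzero v -> exists i, v = ninc (nprev v) i.
Proof.
move=> /forallPn[i0 vi0]; case: (arg_minnP (P := fun i => v i != 0) val vi0).
move=> i vi imin; exists i; apply/funext => j; rewrite /ninc /nprev.
have zlt (k : 'I_d) : k < i -> v k == 0.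
  by apply: contraLR => /imin /=; rewrite -leqNgt.
case: (ltngtP j i) => [ji|ij|/val_inj ->].
- rewrite (eqP (zlt _ ji)) (negbTE (_ : j != i)) ?if_same //.
  by apply: contraTneq ji => ->; rewrite ltnn.
- rewrite (negbTE (_ : j != i)) ?addn0; last first.
    by apply: contraTneq ij => ->; rewrite ltnn.
  case: ifP => // /forallP /(_ i); rewrite ij /=; by rewrite (negbTE vi).
rewrite eqxx; case: ifP => [_|/negbT /forallPn[k]].
  by rewrite addn1 prednK // lt0n.
by rewrite negb_imply => /andP[/zlt ->].
Qed.

(** If all coordinates before [i] vanish, the step towards the origin undoes the increment;
    otherwise it is taken in an earlier coordinate and commutes with it. *)
Lemma nprev_ninc v i : nprev (ninc v i) = v \/
  ~~ nzero v /\ nprev (ninc v i) = ninc (nprev v) i.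
Proof.
have [/forallP vz|/forallPn[j]] := boolP [forall j : 'I_d, (j < i) ==> (v j == 0)].
  left; apply/funext => k; rewrite /nprev /ninc.
  case: (ltngtP k i) => [ki|ik|/val_inj ->].
  - rewrite (negbTE (_ : k != i)) ?addn0; last first.
      by apply: contraTneq ki => ->; rewrite ltnn.
    by have := vz k; rewrite ki /= => /eqP ->; rewrite if_same.
  - rewrite (negbTE (_ : k != i)) ?addn0; last first.
      by apply: contraTneq ik => ->; rewrite ltnn.
    by case: ifP => // /forallP /(_ i); rewrite ik eqxx /= addn1.
  rewrite eqxx addn1; case: ifP => // /negbT /forallPn[l].
  rewrite negb_imply => /andP[li]; have := vz l; rewrite li /= => /eqP ->.
  by rewrite (negbTE (_ : l != i)) //; apply: contraTneq li => ->; rewrite ltnn.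
rewrite negb_imply => /andP[ji vj]; right.
split; first by apply/forallPn; exists j.
apply/funext => k; rewrite /nprev /ninc.
have -> : [forall l : 'I_d, (l < k) ==> (v l + (l == i) == 0)] =
          [forall l : 'I_d, (l < k) ==> (v l == 0)].
  apply/forallP/forallP => hl l; apply/implyP => lk; have := hl l; rewrite lk /=.
    by rewrite addn_eq0 => /andP[].
  move=> /eqP vl; rewrite vl; have [li|//] := eqVneq l i.
  by have := hl j; rewrite -li in ji *; rewrite (ltn_trans ji lk) (negbTE vj).
case: ifP => // /forallP hl; case: eqVneq => [ki|_]; rewrite ?addn0 //.
by have := hl j; rewrite ki ji (negbTE vj).
Qed.

Lemma nzero_ninc v i : nzero (ninc v i) = false.
Proof. by apply/negbTE/forallPn; exists i; rewrite /ninc eqxx addn1. Qed.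

Lemma sum_ninc v i : \sum_j ninc v i j = (\sum_j v j).+1.
Proof.
rewrite /ninc big_split /= -addn1; congr (_ + _).
by rewrite (bigD1 i) //= eqxx big1 // => j /negbTE ->.
Qed.

Variables (z : ('I_d -> nat) -> T) (u : nat -> T).
Hypotheses (zhom : forall v i, e (z v) (z (ninc v i))) (uwalk : walk e u)
  (u0 : u 0 = z (fun=> 0)).

(* [contr t v]: the pattern [z] read at the [t]-th vertex of the canonical path
   from [v] to the origin, followed by the walk [u] from [z 0]. *)
Fixpoint contr (t : nat) (v : 'I_d -> nat) : T :=
  if nzero v then u t else if t is t'.+1 then contr t' (nprev v) else z v.

Lemma contr0 v : contr 0 v = z v.
Proof.
rewrite /=; case: ifP => // /forallP vz; rewrite u0; congr z.
by apply/funext => i; rewrite (eqP (vz i)).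
Qed.

Lemma contrS t v :
  contr t.+1 v = if nzero v then u t.+1 else contr t (nprev v).
Proof. by []. Qed.

Lemma contr_time t v : e (contr t v) (contr t.+1 v).
Proof.
elim: t v => [|t IHt] v; last by rewrite !(contrS _ v); case: ifP.
rewrite contr0; have [vz|vn] := boolP (nzero v).
  by rewrite -contr0 /= vz.
have [i vE] := nprevK vn.
rewrite {1}vE contrS (negbTE vn) contr0 esym.
exact: zhom.
Qed.

(** The path from [ninc v i] either enters [v] at once, which leaves a time step, or runs parallel
    to the path from [v]. *)
Lemma contr_space t v i : e (contr t v) (contr t (ninc v i)).
Proof.
elim: t v => [|t IHt] v; first by rewrite !contr0.
have [vE|[vn vE]] := nprev_ninc v i.
  rewrite esym [X in e X _](_ : _ = contr t v); first exact: contr_time.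
  by rewrite contrS nzero_ninc vE.
by rewrite !contrS nzero_ninc (negbTE vn) vE.
Qed.

Lemma contr_eventually t v : \sum_i v i <= t -> contr t v = u (t - \sum_i v i).
Proof.
elim: t v => [|t IHt] v vt; have [vz|vn] := boolP (nzero v).
- by rewrite /= vz sub0n.
- by have [i vE] := nprevK vn; move: vt; rewrite vE sum_ninc.
- by rewrite /= vz big1 // => i _; apply/eqP/(forallP vz).
have [i vE] := nprevK vn; rewrite /= (negbTE vn).
by move: vt; rewrite {1 3}vE sum_ninc ltnS subSS => /IHt.
Qed.

End Contraction.

(** * Folding and clamping of integers *)

Section Folding.
Variable N : nat.
Hypothesis N_gt0 : 0 < N.

(* Reflecting every odd cell makes patterns on [0, N] with a common boundary
   fit together along the faces of the cells. *)
Definition fold (z : Z) : nat :=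
  Z.to_nat (if Z.even (z / Z.of_nat N) then z mod Z.of_nat N
            else Z.of_nat N - z mod Z.of_nat N)%Z.

Lemma fold_le z : fold z <= N.
Proof.
have := Z.mod_pos_bound z (Z.of_nat N) ltac:(lia).
by rewrite /fold; case: Z.even; lia.
Qed.

Lemma fold_cell_succ z :
  ((z + 1) / Z.of_nat N = z / Z.of_nat N)%Z \/
  ((z + 1) / Z.of_nat N = z / Z.of_nat N + 1 /\
   z mod Z.of_nat N = Z.of_nat N - 1 /\ (z + 1) mod Z.of_nat N = 0)%Z.
Proof.
have := Z.mod_pos_bound z (Z.of_nat N) ltac:(lia).
have := Z.mod_pos_bound (z + 1) (Z.of_nat N) ltac:(lia).
have := Z.div_mod z (Z.of_nat N) ltac:(lia).
have := Z.div_mod (z + 1) (Z.of_nat N) ltac:(lia).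
by nia.
Qed.

Lemma fold_succ z : fold (z + 1) = (fold z).+1 \/ fold z = (fold (z + 1)).+1.
Proof.
have := Z.mod_pos_bound z (Z.of_nat N) ltac:(lia).
have := Z.mod_pos_bound (z + 1) (Z.of_nat N) ltac:(lia).
have := Z.div_mod z (Z.of_nat N) ltac:(lia).
have := Z.div_mod (z + 1) (Z.of_nat N) ltac:(lia).
rewrite /fold; have [->|[-> [-> ->]]] := fold_cell_succ z.
  by case: Z.even; lia.
by rewrite Z.even_add; case: Z.even => /=; lia.
Qed.

Lemma fold_new_cell z :
  ((z + 1) / Z.of_nat N <> z / Z.of_nat N)%Z -> fold (z + 1) = 0 \/ fold (z + 1) = N.
Proof.
move=> ne; have [//|[_ [_ h]]] := fold_cell_succ z.
by rewrite /fold h; case: Z.even; lia.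
Qed.

(** This preimage of [r] in cell [q] is where the filling of that cell is recovered from a
    tiling. *)
Lemma fold_cell (q : Z) (r : nat) : 0 < r < N ->
  let z := (Z.of_nat N * q + (if Z.even q then Z.of_nat r
                              else Z.of_nat N - Z.of_nat r))%Z in
  (z / Z.of_nat N)%Z = q /\ fold z = r.
Proof.
move=> rN z.
have zq : (z / Z.of_nat N)%Z = q.
  by symmetry; apply: Z.div_unique; last reflexivity; case: Z.even; lia.
split=> //; rewrite /fold zq.
have -> : (z mod Z.of_nat N)%Z = (z - Z.of_nat N * q)%Z.
  by have := Z.div_mod z (Z.of_nat N) ltac:(lia); rewrite zq; lia.
by rewrite /z; case: Z.even; lia.
Qed.

(** Unit steps change [fold] by one, starting from [fold 0 = 0]. This controls the phase of the
    outer checkerboard. *)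
Lemma odd_fold z : odd (fold z) = Z.odd z.
Proof.
have step y : odd (fold (y + 1)) = ~~ odd (fold y).
  by have [->|->] := fold_succ y; rewrite //= negbK.
have f0 : fold 0 = 0 by rewrite /fold Zdiv.Zdiv_0_l Zdiv.Zmod_0_l.
elim/Z.peano_ind: z => [|z IHz|z IHz]; first by rewrite f0.
  by rewrite -Z.add_1_r step IHz Z.odd_add; case: Z.odd.
have := step (Z.pred z); rewrite -[(_ + 1)%Z]/(Z.succ _) Z.succ_pred IHz Z.odd_pred.
by rewrite -Z.negb_odd => ->; rewrite negbK.
Qed.

End Folding.

Section Clamping.
Variable L : Z.
Hypothesis L_ge0 : (0 <= L)%Z.

Definition clamp (z : Z) : Z := Z.max 0 (Z.min z L).

(** The distance from [z] to [[0, L]]; inside the interval [Z.to_nat] truncates to 0. *)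
Definition exc (z : Z) : nat := Z.to_nat (Z.max (- z) (z - L)).

(** A unit step moves either the projection or the distance, never both, so a lattice edge becomes a
    space step or a time step of [contr]. *)
Lemma clamp_exc_succ z :
  (clamp (z + 1) = clamp z + 1 /\ exc (z + 1) = exc z)%Z \/
  clamp (z + 1) = clamp z /\ (exc (z + 1) = (exc z).+1 \/ exc z = (exc (z + 1)).+1).
Proof.
rewrite /clamp /exc; have [z0|z0] := Z.lt_ge_cases z 0; first by right; lia.
by have [zL|zL] := Z.lt_ge_cases z L; [left | right]; lia.
Qed.

Lemma odd_clamp_exc z : Z.odd (clamp z) (+) odd (exc z) = Z.odd z.
Proof.
have oddE (y : Z) : (0 <= y)%Z -> odd (Z.to_nat y) = Z.odd y.
  move=> y0; rewrite -[in RHS](Z2Nat.id y) //; elim: (Z.to_nat y) => // n IHn.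
  by rewrite Nat2Z.inj_succ Z.odd_succ -Z.negb_odd -IHn.
rewrite /clamp /exc; have [z0|z0] := Z.lt_ge_cases z 0.
  rewrite Z.max_l ?Z.max_l; try lia.
  by rewrite oddE ?Z.odd_opp //; lia.
have [zL|zL] := Z.lt_ge_cases L z.
  rewrite !Z.max_r ?Z.min_r; try lia.
  by rewrite oddE ?Z.odd_sub; [case: Z.odd; case: Z.odd | lia].
have -> : Z.to_nat (Z.max (- z) (z - L)) = 0 by lia.
by rewrite Z.max_r ?Z.min_l ?addbF; lia.
Qed.

End Clamping.

(** * Reflected tilings of a box and their continuation outside *)

Section Tiling.
Variables (d : nat) (T : finType) (e : rel T) (v0 v1 : T).
Hypothesis esym : symmetric e.
Variables (N M S : nat) (z : ('I_d -> nat) -> T) (u : nat -> T).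
Variable fill : pt d -> ('I_d -> nat) -> T.
Hypotheses (N_gt0 : 0 < N)
  (zhom : forall v i, e (z v) (z (ninc v i))) (uwalk : walk e u)
  (u0 : u 0 = z (fun=> 0)) (uS : forall n, u (S + n) = if odd n then v1 else v0)
  (fill_hom : forall c v i, e (fill c v) (fill c (ninc v i)))
  (fill_bd : forall c v, (forall i, v i <= N) -> (exists i, v i = 0 \/ v i = N) ->
     fill c v = z v).

Let L := Z.of_nat (M * N).

Let L_ge0 : (0 <= L)%Z. Proof. by rewrite /L; lia. Qed.

Definition foldp (p : pt d) : 'I_d -> nat := fun i => fold N (p i).
Definition cellp (p : pt d) : pt d := fun i => (p i / Z.of_nat N)%Z.
Definition clampp (p : pt d) : pt d := fun i => clamp L (p i).
Definition tile (p : pt d) : T := fill (cellp p) (foldp p).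
Definition outer (p : pt d) : T :=
  contr z u (\sum_i exc L (p i)) (foldp (clampp p)).
Definition inbox (p : pt d) : bool :=
  [forall i, (0 <=? p i)%Z && (p i <=? L)%Z].
Definition tiling (p : pt d) : T := if inbox p then tile p else outer p.

Lemma inboxP p : reflect (forall i, 0 <= p i <= L)%Z (inbox p).
Proof.
apply: (iffP forallP) => h i; have := h i.
  by move=> /andP[/Z.leb_spec0 ? /Z.leb_spec0].
by case=> ? ?; apply/andP; split; apply/Z.leb_spec0.
Qed.

Lemma foldp_pinc p i :
  foldp (pinc p i) = ninc (foldp p) i \/ foldp p = ninc (foldp (pinc p i)) i.
Proof.
have [h|h] := fold_succ N_gt0 (p i); [left|right]; apply/funext => j;
  rewrite /foldp /ninc /pinc; case: eqVneq => [->|_];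
  by rewrite ?Z.add_0_r ?addn0 // h addn1.
Qed.

Lemma foldp_hom (y : ('I_d -> nat) -> T) p i :
  (forall v j, e (y v) (y (ninc v j))) ->
  e (y (foldp p)) (y (foldp (pinc p i))).
Proof.
by move=> yh; have [->|->] := foldp_pinc p i; rewrite // esym.
Qed.

Lemma tile_hom : Hom e tile.
Proof.
apply/(Hom_pinc esym) => p i; rewrite /tile.
have [cE|cN] := pselect (cellp (pinc p i) = cellp p).
  by rewrite cE; apply: foldp_hom.
have cN' : ((p i + 1) / Z.of_nat N <> p i / Z.of_nat N)%Z.
  move=> h; apply: cN; apply/funext => j; rewrite /cellp /pinc.
  by case: eqVneq => [->|_]; rewrite ?Z.add_0_r.
(* A step into a new cell ends on a common face, where the fillings of both cells equal [z]; the end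
   value can thus be read in the cell of [p]. *)
rewrite (fill_bd (cellp (pinc p i))) -?(fill_bd (cellp p)).
- exact: foldp_hom.
- by move=> j; apply: fold_le.
- exists i; rewrite /foldp /pinc eqxx; exact: fold_new_cell.
- by move=> j; apply: fold_le.
- exists i; rewrite /foldp /pinc eqxx; exact: fold_new_cell.
Qed.

Lemma outer_hom : Hom e outer.
Proof.
apply/(Hom_pinc esym) => p i; rewrite /outer.
have sumE : \sum_j exc L (pinc p i j) + exc L (p i) =
            \sum_j exc L (p j) + exc L (p i + 1).
  rewrite (bigD1 i) //= [in RHS](bigD1 i) //= {1}/pinc eqxx.
  rewrite (eq_bigr (fun j => exc L (p j))); first by lia.
  by move=> j /negbTE ji; rewrite /pinc ji Z.add_0_r.
have [[cE xE]|[cE xE]] := clamp_exc_succ L_ge0 (p i).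
  have -> : \sum_j exc L (pinc p i j) = \sum_j exc L (p j) by lia.
  have -> : clampp (pinc p i) = pinc (clampp p) i.
    apply/funext => j; rewrite /clampp /pinc; case: eqVneq => [->|_] //.
    by rewrite !Z.add_0_r.
  by apply: foldp_hom => v j; apply: contr_space.
have -> : clampp (pinc p i) = clampp p.
  apply/funext => j; rewrite /clampp /pinc; case: eqVneq => [->|_] //.
  by rewrite !Z.add_0_r.
have [] : \sum_j exc L (pinc p i j) = (\sum_j exc L (p j)).+1 \/
          \sum_j exc L (p j) = (\sum_j exc L (pinc p i j)).+1 by lia.
  by move=> ->; apply: contr_time.
by move=> ->; rewrite esym; apply: contr_time.
Qed.

Lemma outer_inbox p : inbox p -> outer p = z (foldp p).
Proof.
move=> /inboxP pin; rewrite /outer big1 => [|i _]; last first.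
  by have := pin i; rewrite /exc; lia.
rewrite contr0 //; congr z; apply/funext => i; congr fold.
by have := pin i; rewrite /clampp /clamp; lia.
Qed.

(** Such a [p] has a coordinate 0 or [L]; as [L] is a multiple of [N], it folds to a boundary
    position, where every filling equals [z]. *)
Lemma tile_frontier p q : inbox p -> ~~ inbox q -> adjZ p q -> tile p = outer p.
Proof.
move=> pin qout pq; rewrite outer_inbox // /tile fill_bd //.
  by move=> i; apply: fold_le.
case: pq => i [s [hs hq]]; exists i; rewrite /foldp.
have [->|->] : p i = 0%Z \/ p i = L.
- apply: contrapT => ni; move/negP: qout; apply; apply/inboxP => j.
  move/inboxP: pin => pin; rewrite hq; have := pin j.
  by case: eqVneq => [->|_]; lia.
- by left; rewrite /fold Zdiv.Zdiv_0_l Zdiv.Zmod_0_l.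
have -> : (fold N L = fold N (Z.of_nat M * Z.of_nat N)) by rewrite /L Nat2Z.inj_mul.
by rewrite /fold Zdiv.Z_mod_mult Z.sub_0_r; case: Z.even; lia.
Qed.

Lemma tiling_hom : Hom e tiling.
Proof.
move=> p q pq; rewrite /tiling; have qp := adjZ_sym pq.
case: ifP => pin; case: ifP => qin.
- exact: tile_hom.
- by rewrite (tile_frontier pin (negbT qin)) //; apply: outer_hom.
- by rewrite (tile_frontier qin (negbT pin)) //; apply: outer_hom.
- exact: outer_hom.
Qed.

(** At most [d * N] steps lead from a folded point to the origin, and [S] more reach the
    alternation. As folding and clamping respect parity, the values reached form a checkerboard. *)
Lemma tiling_far p i :
  (p i <= - Z.of_nat (d * N + S).+1 \/ L + Z.of_nat (d * N + S).+1 <= p i)%Z ->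
  tiling p = chk v0 v1 (odd S) p.
Proof.
move=> far; have pout : ~~ inbox p.
  by apply/negP => /inboxP /(_ i); lia.
rewrite /tiling (negbTE pout) /outer.
set t := \sum_i _; set v := foldp _.
have tS : d * N + S <= t.
  by rewrite /t (bigD1 i) //= /exc; lia.
have vN : \sum_i v i <= d * N.
  rewrite -[d in d * N]card_ord -sum_nat_const; apply: leq_sum => j _.
  exact: fold_le.
rewrite contr_eventually; last by lia.
have -> : t - \sum_i v i = S + (t - \sum_i v i - S) by lia.
rewrite uS /chk; congr (if _ then _ else _).
have pE : par p = odd t (+) odd (\sum_i v i).
  rewrite /par /t !(big_morph odd oddD (erefl _)) -big_split.
  apply: eq_bigr => j _; rewrite /v /foldp odd_fold // /clampp /= addbC.
  by rewrite odd_clamp_exc.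
rewrite pE !oddB; [ by [] | by lia | by lia ].
Qed.

End Tiling.

(** * Counting *)

Lemma pigeonhole_fiber (X Y : finType) (A : {set X}) (g : X -> Y) (a : X) :
  a \in A -> exists y, #|A| <= #|Y| * #|[set x in A | g x == y]|.
Proof.
move=> aA; pose F y := #|[set x in A | g x == y]|.
case: (arg_maxnP (i0 := g a) (P := predT) F isT) => y _ ymax; exists y.
rewrite -sum1_card (partition_big g predT) //= -sum_nat_const.
apply: leq_sum => y' _; apply: leq_trans (ymax y' isT).
by rewrite /F -sum1_card; apply: eq_leq; apply: eq_bigl => x; rewrite inE.
Qed.

(** Neighbouring cells share faces, so the cell [[0, N]^d] has [N.+1] points per side. *)
Definition boundary (d N : nat) : {set bx d N.+1} :=
  [set f : bx d N.+1 | [exists i, (f i == 0 :> nat) || (f i == N :> nat)]].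

(** The boundary is thus of lower order than the volume, and the pigeonhole loss vanishes in the
    limit. *)
Lemma card_boundary (d N : nat) : #|boundary d N| + N.-1 ^ d <= N.+1 ^ d.
Proof.
pose I := [pred x : 'I_N.+1 | 0 < x < N].
have IE (x : 'I_N.+1) : (x \in I) = ~~ ((x == 0 :> nat) || (x == N :> nat)).
  by rewrite inE /=; have := ltn_ord x; lia.
have cI : N.-1 <= #|I|.
  have cE : #|I| + #|[predC I]| = N.+1 by rewrite cardC card_ord.
  have : #|[predC I]| <= 2.
    apply: leq_trans (subset_leq_card (_ : _ \subset pred2 ord0 ord_max)) _.
      apply/subsetP => x; rewrite !inE -!val_eqE /=; have := ltn_ord x.
      by case: (val x) => //= n; lia.
    by rewrite card2; case: eqP.
  by lia.
have <- : #|boundary d N| + #|~: boundary d N| = N.+1 ^ d.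
  by rewrite cardsC card_ffun !card_ord.
rewrite leq_add2l; have <- : #|[pred f : bx d N.+1 | f \in ffun_on I]| = #|~: boundary d N|.
  apply: eq_card => f; rewrite !inE negb_exists.
  by apply: eq_forallb => i; rewrite IE.
rewrite card_ffun_on card_ord.
by have [->|d_gt0] := posnP d; rewrite ?expn0 ?leq_exp2r.
Qed.

(** Cells have coordinates from 0, boxes from 1; hence the shift. *)
Definition nat_pt (d : nat) (v : 'I_d -> nat) : pt d := fun i => Z.of_nat (v i).+1.

Lemma nat_pt_ninc (d : nat) (v : 'I_d -> nat) i : nat_pt (ninc v i) = pinc (nat_pt v) i.
Proof.
by apply/funext => j; rewrite /nat_pt /ninc /pinc; case: eqP => _ /=; lia.
Qed.

Section Counting.
Variables (d : nat) (T : finType) (e : rel T) (v0 v1 : T).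
Hypotheses (esym : symmetric e) (econn : graph_connected e) (e01 : e v0 v1).

Definition homset (N : nat) : {set {ffun bx d N -> T}} :=
  [set r | `[< exists c, Hom e c /\ restrict N c = r >]].

Definition bdr N (r : {ffun bx d N.+1 -> T}) : {ffun {f | f \in boundary d N} -> T} :=
  [ffun f => r (val f)].

(** Members of a large class [C] of cell patterns with a common boundary are placed independently in
    the cells. The margin [R] on each side of the tiled box holds the return to the checkerboard. *)
Lemma count_chkfam_lower N : 0 < N -> exists R, forall M n,
  2 * R + M.+1 * N <= n ->
  #|homset N.+1| ^ (M.+1 ^ d) <= #|T| ^ (#|boundary d N| * M.+1 ^ d) *
    count_box n (@chkfam d T e v0 v1 (boxset n)).
Proof.
move=> N_gt0.
have chkin : restrict N.+1 (@chk d T v0 v1 false) \in homset N.+1.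
  by rewrite inE; apply/asboolP; exists (chk v0 v1 false); split=> //; apply: Hom_chk.
have [b bP] := pigeonhole_fiber (@bdr N) chkin.
set C := [set r in _ | _] in bP.
have [r0 r0C] : exists r, r \in C.
  apply/set0Pn; apply: contraTneq bP => ->.
  by rewrite cards0 muln0 leqn0 cards_eq0; apply/set0Pn; exists (restrict N.+1 (chk v0 v1 false)).
(* A default checkerboard outside [C] makes [lift r] a homomorphism for every [r]. *)
have /choice[lift liftP] (r : {ffun bx d N.+1 -> T}) : exists x : pt d -> T,
    Hom e x /\ (r \in C -> restrict N.+1 x = r).
  have [/setIdP[]|_] := boolP (r \in C).
    by rewrite inE => /asboolP[x [hx xr]] _; exists x.
  by exists (chk v0 v1 false); split=> //; apply: Hom_chk.
pose at_ r v := lift r (nat_pt v).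
have at_hom r v i : e (at_ r v) (at_ r (ninc v i)).
  by have [/(Hom_pinc esym) hr _] := liftP r; rewrite /at_ nat_pt_ninc.
have at_val r (f : bx d N.+1) : r \in C -> at_ r (fun i => f i) = r f.
  by move=> rC; rewrite -[in RHS]((liftP r).2 rC) ffunE.
have at_bd r v : r \in C -> (forall i, v i <= N) ->
    (exists i, v i = 0 \/ v i = N) -> at_ r v = at_ r0 v.
  move=> rC vN [i vi]; pose f : bx d N.+1 := [ffun i => inord (v i)].
  have -> : v = (fun i => f i : nat) by apply/funext => j; rewrite ffunE inordK ?ltnS.
  have fb : f \in boundary d N.
    rewrite inE; apply/existsP; exists i; rewrite ffunE inordK ?ltnS //.
    by case: vi => ->; rewrite eqxx ?orbT.
  rewrite !at_val //; move: rC r0C; rewrite !inE => /andP[_ /eqP <-] /andP[_ /eqP].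
  by move/ffunP/(_ (exist _ f fb)); rewrite !ffunE.
have [u [S [uw u0 uS]]] :=
  connect_eventually_alternating_walk esym (econn (at_ r0 (fun=> 0)) v0) e01.
pose R := (d * N + S).+1; exists R => M n nR.
(* Cells out of range get index 0; any member of [C] is admissible there. *)
pose idx (c : pt d) : bx d M.+1 := [ffun i => inord (Z.to_nat (c i))].
pose fill (g : {ffun bx d M.+1 -> {ffun bx d N.+1 -> T}}) c := at_ (g (idx c)).
pose a : pt d := fun=> Z.of_nat R.
pose x g p := tiling N M.+1 (at_ r0) u (fill g) (psub p a).
have xP g : g \in ffun_on C -> @chkfam d T e v0 v1 (boxset n) (x g).
  move=> /ffun_onP gC; exists (x g), (par a (+) odd S); split=> //.
    move=> p q [i [t [ht hq]]]; apply: tiling_hom => //.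
    - by move=> c v i'; apply: at_hom.
    - by move=> c v; apply: at_bd; apply: gC.
    - by exists i, t; split=> // j; rewrite /psub hq; lia.
  move=> p /existsNP[i ni]; rewrite /chk addbA -par_psub.
  apply: (@tiling_far _ _ _ _ _ _ _ _ _ _ _ _ _ i) => //.
  by rewrite /psub /a -/R; lia.
have x_inj : {in ffun_on C &, injective (fun g => restrict n (x g))}.
  move=> g g' /ffun_onP gC /ffun_onP gC' /ffunP eqx.
  apply/ffunP => c; apply/ffunP => f.
  have [fb|fi] := boolP (f \in boundary d N).
    move: (gC c) (gC' c); rewrite !inE => /andP[_ /eqP <-] /andP[_ /eqP].
    by move/ffunP/(_ (exist _ f fb)); rewrite !ffunE.
  have fN i : 0 < f i < N.
    have := ltn_ord (f i); move: fi; rewrite inE negb_exists => /forallP /(_ i).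
    by move: (nat_of_ord (f i)) => k; lia.
  (* The point of cell [c] that folds to the interior position [f]. *)
  pose q : pt d := fun i => let ci := Z.of_nat (c i) in
    (Z.of_nat N * ci + (if Z.even ci then Z.of_nat (f i)
                        else Z.of_nat N - Z.of_nat (f i)))%Z.
  have qc i : (q i / Z.of_nat N)%Z = Z.of_nat (c i).
    by have [] := fold_cell N_gt0 (Z.of_nat (c i)) (fN i).
  have qf i : fold N (q i) = f i.
    by have [] := fold_cell N_gt0 (Z.of_nat (c i)) (fN i).
  have qin i : (0 <= q i <= Z.of_nat (M.+1 * N))%Z.
    have := fN i; have := ltn_ord (c i); rewrite /q.
    by case: Z.even; nia.
  have tileE h : tiling N M.+1 (at_ r0) u (fill h) q = at_ (h c) (fun i => f i).
    rewrite /tiling ifT; last by apply/inboxP.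
    rewrite /tile /fill; congr at_; last by apply/funext => i; apply: qf.
    congr (h _); apply/ffunP => i; rewrite ffunE /cellp qc Nat2Z.id.
    by apply: val_inj; rewrite /= inordK.
  have qn i : Z.to_nat (q i + Z.of_nat R - 1) < n by have := qin i; lia.
  have := eqx [ffun i => Ordinal (qn i)]; rewrite !ffunE /x.
  have -> : psub (pt_of [ffun i => Ordinal (qn i)]) a = q.
    apply/funext => i; rewrite /psub /pt_of ffunE /a; have := qin i.
    have -> : nat_of_ord (Ordinal (qn i)) = Z.to_nat (q i + Z.of_nat R - 1) by [].
    by have : 0 < R by []; lia.
  by rewrite !tileE !at_val.
have cC : #|C| ^ (M.+1 ^ d) <= count_box n (@chkfam d T e v0 v1 (boxset n)).
  have <- : #|[pred g : {ffun bx d M.+1 -> {ffun bx d N.+1 -> T}} | g \in ffun_on C]| = #|C| ^ (M.+1 ^ d).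
    by rewrite card_ffun_on card_ffun !card_ord.
  rewrite -(card_in_imset (D := ffun_on C) x_inj); apply: subset_leq_card; apply/subsetP => r.
  case/imsetP=> g gC ->; rewrite inE; apply/asboolP; exists (x g); split=> //.
  exact: xP.
rewrite expnM; apply: leq_trans (leq_mul (leqnn _) cC).
rewrite -expnMn leq_exp2r ?expn_gt0 //; apply: leq_trans bP _.
by rewrite card_ffun card_sig leq_mul.
Qed.

End Counting.

(** * Passage from the counting inequality to entropies *)

Section EntropyLimits.
Local Open Scope R_scope.

(* Junk value: the standard library extends [ln] by [0] to nonpositive reals. *)
Lemma ln_0 : ln 0 = 0.
Proof. by rewrite /ln; case: Rlt_dec => // h; case: (Rlt_irrefl _ h). Qed.

Lemma ln_INR_ge0 (m : nat) : 0 <= ln (INR m).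
Proof.
case: m => [|m]; first by rewrite ln_0; lra.
rewrite -ln_1; apply: ln_le; first lra.
by rewrite S_INR; have := pos_INR m; lra.
Qed.

Lemma ln_INR_le (m n : nat) : (m <= n)%N -> ln (INR m) <= ln (INR n).
Proof.
move=> /leP mn; case: m mn => [|m] mn.
  by rewrite ln_0; apply: ln_INR_ge0.
by apply: ln_le; [apply: lt_0_INR; lia | apply: le_INR].
Qed.

Lemma INR_expn (m n : nat) : INR (m ^ n)%N = INR m ^ n.
Proof. by elim: n => [|n IHn] //; rewrite expnS mult_INR IHn. Qed.

Lemma ln_INR_expn (m n : nat) : (0 < m)%N -> ln (INR (m ^ n)%N) = INR n * ln (INR m).
Proof. by move=> m0; rewrite INR_expn ln_pow //; apply: lt_0_INR; apply/ltP. Qed.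

Lemma is_lim_seq_inv_succ : is_lim_seq (fun n => / INR n.+1) 0.
Proof.
apply: (is_lim_seq_inv _ p_infty) => //.
by apply/(is_lim_seq_incr_1 INR); apply: is_lim_seq_INR.
Qed.

Lemma is_lim_seq_pow_const (u : nat -> R) (l : R) (d : nat) :
  is_lim_seq u l -> is_lim_seq (fun n => u n ^ d) (l ^ d).
Proof.
apply: (is_lim_seq_continuous (fun x => x ^ d)).
by apply: derivable_continuous_pt; apply: derivable_pt_pow.
Qed.

Lemma is_lim_seq_affine_inv_succ (a b : R) :
  is_lim_seq (fun n => a - b * / INR n.+1) a.
Proof.
have -> : Rbar.Finite a = a - b * 0 by congr Rbar.Finite; ring.
apply: is_lim_seq_minus'; first exact: is_lim_seq_const.
exact: (is_lim_seq_scal_l _ b 0 is_lim_seq_inv_succ).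
Qed.

Lemma is_lim_seq_quotient (N r : nat) : (0 < N)%N ->
  is_lim_seq (fun n => INR ((n.+1 - r) %/ N) / INR n.+1) (/ INR N).
Proof.
move=> N0; have N0' : 0 < INR N by apply: lt_0_INR; apply/ltP.
apply: (is_lim_seq_le_le
  (fun n => / INR N - (INR r / INR N + 1) * / INR n.+1) _ (fun=> / INR N)); last first.
- exact: is_lim_seq_const.
- exact: is_lim_seq_affine_inv_succ.
move=> n; have n0 : 0 < INR n.+1 by apply: lt_0_INR; lia.
set q := (_ %/ N)%N.
have q1 : INR q * INR N <= INR n.+1.
  rewrite -mult_INR; apply: le_INR; apply/leP.
  by apply: leq_trans (leq_divM _ _) _; lia.
have q2 : INR n.+1 <= INR q * INR N + INR N + INR r.
  rewrite -mult_INR -!plus_INR; apply: le_INR; apply/leP.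
  by have := ltn_ceil (n.+1 - r) N0; rewrite -/q; nia.
have -> : / INR N - (INR r / INR N + 1) * / INR n.+1 =
    (INR n.+1 - INR r - INR N) / (INR N * INR n.+1) by field; lra.
have -> : INR q / INR n.+1 = (INR q * INR N) / (INR N * INR n.+1) by field; lra.
have -> : / INR N = INR n.+1 / (INR N * INR n.+1) by field; lra.
have p0 : 0 <= / (INR N * INR n.+1).
  by apply: Rlt_le; apply: Rinv_0_lt_compat; apply: Rmult_lt_0_compat.
by split; apply: Rmult_le_compat_r => //; lra.
Qed.

Lemma LimInf_is_lim (u : nat -> R) (l : Rbar) : is_lim_seq u l -> LimInf_seq u = l.
Proof. by move=> /is_lim_LimInf_seq /is_LimInf_seq_unique. Qed.

Lemma LimSup_is_lim (u : nat -> R) (l : Rbar) : is_lim_seq u l -> LimSup_seq u = l.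
Proof. by move=> /is_lim_LimSup_seq /is_LimSup_seq_unique. Qed.

(** [Lim_seq] is the mean of the lower and upper limits, so both limits of [b] are shown to equal
    the lower limit of [a]. The bounds [m] and [M] make the latter finite. *)
Lemma LimInf_eq_Lim_seq (a b : nat -> R) (m M : R) :
  (forall n, m <= a n) -> (forall n, a n <= b n) -> (forall n, b n <= M) ->
  (forall l : R, LimInf_seq a = l -> Rbar_le (LimSup_seq b) l) ->
  LimInf_seq a = Lim_seq b.
Proof.
move=> ma ab bM key.
have evW (P : nat -> Prop) : (forall n, P n) -> eventually P by exists 0%N.
have la : Rbar_le m (LimInf_seq a).
  by rewrite -(LimInf_seq_const m); apply: LimInf_le; apply: evW.
have lab : Rbar_le (LimInf_seq a) (LimInf_seq b) by apply: LimInf_le; apply: evW.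
have lM : Rbar_le (LimInf_seq a) M.
  rewrite -(LimInf_seq_const M); apply: LimInf_le; apply: evW => n.
  exact: Rle_trans (bM n).
case aE : (LimInf_seq a) la lM lab => [l| |] //= _ _ lb.
have sb := key _ aE; have is_ := LimSup_LimInf_seq_le b.
have bi : LimInf_seq b = l.
  by apply: Rbar_le_antisym => //; apply: Rbar_le_trans sb.
have bs : LimSup_seq b = l.
  by apply: Rbar_le_antisym => //; rewrite -bi.
by rewrite /Lim_seq bi bs /=; congr Rbar.Finite; lra.
Qed.

(** For fixed [N], letting the box grow bounds the entropy of one cell, less its boundary cost, by
    the lower limit [l] of [c]. Then [N] grows, and the boundary cost disappears. *)
Lemma entropy_squeeze (d tau : nat) (h c bd : nat -> nat) :
  (0 < tau)%N -> (forall n, 0 < h n <= tau ^ (n.+1 ^ d))%N ->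
  (forall n, c n <= h n)%N -> (forall n, bd n + n.-1 ^ d <= n.+1 ^ d)%N ->
  (forall N, 0 < N -> exists R, forall M n, 2 * R + M.+1 * N <= n.+1 ->
     h N ^ (M.+1 ^ d) <= tau ^ (bd N * M.+1 ^ d) * c n)%N ->
  LimInf_seq (fun n => ln (INR (c n)) / INR n.+1 ^ d) =
  Lim_seq (fun n => ln (INR (h n)) / INR n.+1 ^ d).
Proof.
move=> tau0 hb ch bdb low.
have pos n : 0 < INR n.+1 by apply: lt_0_INR; lia.
have posd n : 0 < INR n.+1 ^ d by apply: pow_lt.
have ipd n : 0 <= / INR n.+1 ^ d by apply: Rlt_le; apply: Rinv_0_lt_compat.
set t := ln (INR tau).
apply: (@LimInf_eq_Lim_seq _ _ 0 t) => [n|n|n|l lE].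
- by apply: Rmult_le_pos => //; apply: ln_INR_ge0.
- by apply: Rmult_le_compat_r => //; apply: ln_INR_le.
- apply/Rle_div_l; first exact: posd.
  rewrite -INR_expn Rmult_comm /t -ln_INR_expn //.
  by apply: ln_INR_le; case/andP: (hb n).
have key N : (0 < N)%N -> (ln (INR (h N)) - INR (bd N) * t) / INR N ^ d <= l.
  move=> N0; have [R lowR] := low _ N0; set K := _ - _.
  pose mu n := INR ((n.+1 - 2 * R) %/ N) / INR n.+1.
  have lim : is_lim_seq (fun n => mu n ^ d * K) (Rbar_mult ((/ INR N) ^ d) K).
    by apply: is_lim_seq_scal_r; apply: is_lim_seq_pow_const; apply: is_lim_seq_quotient.
  have : Rbar_le (LimInf_seq (fun n => mu n ^ d * K)) l.
    rewrite -lE; apply: LimInf_le; exists (2 * R + N)%N => n /leP nN.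
    (* As many cells as fit between two margins [R]; the predecessor is taken because [low] counts
       [M.+1] cells per side. *)
    have := lowR ((n.+1 - 2 * R) %/ N).-1 n.
    rewrite prednK; last by rewrite divn_gt0 //; lia.
    set q := (_ %/ _)%N; have := leq_divM (n.+1 - 2 * R) N; rewrite -/q => qN.
    move=> /(_ ltac:(lia)) hq.
    (* [ln] of the product is split for positive factors; [c n = 0] would force [h N = 0]. *)
    have c0 : (0 < c n)%N.
      case: (posnP (c n)) hq => // ->; rewrite muln0 leqn0 expn_eq0.
      by case/andP: (hb N) => /lt0n_neq0 /negbTE ->.
    have := ln_INR_le hq; rewrite mult_INR ln_mult.
    - rewrite !ln_INR_expn //; last by case/andP: (hb N).
      rewrite mult_INR INR_expn -/t => hq'.
      have -> : mu n ^ d * K = (INR q ^ d * K) / INR n.+1 ^ d.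
        by rewrite /mu -/q /Rdiv Rpow_mult_distr pow_inv; ring.
      apply: Rmult_le_compat_r => //; rewrite /K; lra.
    - by apply: lt_0_INR; apply/ltP; rewrite expn_gt0 tau0.
    - by apply: lt_0_INR; apply/ltP.
  rewrite (LimInf_is_lim lim) /= pow_inv => h1.
  by apply: Rle_trans h1; right; rewrite /Rdiv Rmult_comm.
(* Here [key] is divided by [INR n.+1 ^ d], with [bd n] bounded by [n.+1 ^ d - n.-1 ^ d]; the ratios
   of sides are 1 - 1/(n+1) and 1 - 2/(n+1). *)
pose rhs n := l * (1 - 1 * / INR n.+1) ^ d + (1 - (1 - 2 * / INR n.+1) ^ d) * t.
have lim : is_lim_seq rhs l.
  have -> : l = l * 1 ^ d + (1 - 1 ^ d) * t by rewrite pow1; ring.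
  apply: is_lim_seq_plus'.
    apply: is_lim_seq_mult'; first exact: is_lim_seq_const.
    by apply: is_lim_seq_pow_const; apply: is_lim_seq_affine_inv_succ.
  apply: is_lim_seq_mult'; last exact: is_lim_seq_const.
  apply: is_lim_seq_minus'; first exact: is_lim_seq_const.
  by apply: is_lim_seq_pow_const; apply: is_lim_seq_affine_inv_succ.
rewrite -(LimSup_is_lim lim); apply: LimSup_le; exists 1%N => n /leP n1.
have n0 : 0 < INR n by apply: lt_0_INR; apply/ltP.
have := key _ n1; move/Rle_div_l => /(_ (pow_lt _ _ n0)) kn.
apply/Rle_div_l; first exact: posd.
rewrite /rhs Rmult_plus_distr_r.
have -> : l * (1 - 1 * / INR n.+1) ^ d * INR n.+1 ^ d = l * INR n ^ d.
  rewrite Rmult_assoc -Rpow_mult_distr; congr (_ * _ ^ _).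
  by have := pos n; rewrite S_INR => ?; field; lra.
have -> : (1 - (1 - 2 * / INR n.+1) ^ d) * t * INR n.+1 ^ d =
    (INR n.+1 ^ d - INR n.-1 ^ d) * t.
  have -> : INR n.-1 = (1 - 2 * / INR n.+1) * INR n.+1.
    rewrite -[n in INR n.+1](prednK n1) !S_INR; have := pos_INR n.-1 => ?.
    by field; lra.
  by rewrite Rpow_mult_distr; ring.
have := bdb n => /leP /le_INR; rewrite plus_INR !INR_expn => bdn.
have t0 : 0 <= t by apply: ln_INR_ge0.
by have := Rmult_le_compat_r _ _ _ t0 bdn; lra.
Qed.

End EntropyLimits.

(** * Property F and equality of entropies for the checkerboard family *)

Theorem theorem10p1 (d : nat) (T : finType) (e : rel T) :
  (0 < d)%N ->
  symmetric e ->
  graph_connected e ->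
  ~ bipartite e ->
  exists (k m : nat) (P : patfam d T),
    property_F_with (@Hom d T e) k m P /\
    entropy_family k P = top_entropy (@Hom d T e).
Proof.
move=> _ esym econn nbip; have [v0 [v1 e01]] := nonbipartite_edge nbip.
have [m PF] := chkfam_property_F d esym e01 econn nbip.
exists 1, m, (chkfam e v0 v1); split=> //.
rewrite /entropy_family /top_entropy.
under [X in LimInf_seq X]eq_fun do rewrite muln1.
apply: (entropy_squeeze (tau := #|T|) (bd := fun n => #|boundary d n|)) => [|n|n|n|N N_gt0].
- by apply/card_gt0P; exists v0.
- apply/andP; split.
    apply/card_gt0P; exists (restrict n.+1 (chk v0 v1 false)).
    rewrite inE; apply/asboolP; exists (chk v0 v1 false).
    by split=> //; apply: (Hom_chk esym e01).
  by apply: leq_trans (max_card _) _; rewrite !card_ffun !card_ord.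
- apply: subset_leq_card; apply/subsetP => r; rewrite !inE => /asboolP[c [Pc <-]].
  case: Pc => x [s [hx xc _]]; apply/asboolP; exists x; split=> //.
  apply/ffunP => f; rewrite !ffunE; apply: xc => i; rewrite /pt_of.
  by have := ltn_ord (f i); move: (nat_of_ord _) => k; lia.
- exact: card_boundary.
have [R lowR] := count_chkfam_lower d esym econn e01 N_gt0.
by exists R => M n; apply: lowR.
Qed.
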